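(* Let $r \in \mathbb{N}$ and let $X \subset \mathrm{Path}_r$ be a minimal path space. Then exactly one of the following holds: (1) every path in $X$ is uniformly ascending, (2) every path in $X$ is uniformly descending, (3) every path in $X$ is uniformly bounded, or (4) every path in $X$ is unbounded, and some path in $X$ is infinite-to-one.
   Context: $\mathrm{Path}_r$ is the space of all functions $p : \mathbb{Z} \to \mathbb{Z}$ with $p(0) = 0$ and $|p(i+1)-p(i)| \leq r$ for all $i$, with the product topology and the homeomorphism $\tau(p)(i) = p(i+1) - p(1)$. A minimal path space is a nonempty closed $\tau$-invariant subset of $\mathrm{Path}_r$ that is minimal as a dynamical system (contains no nonempty proper closed $\tau$-invariant subset). A path $p$ is ascending if for some $m \in \mathbb{N}$, $p(j+m+1) - p(j) > 0$ for all $j \in \mathbb{Z}$; descending is defined symmetrically ($p(j+m+1)-p(j) < 0$ for all $j$); bounded if $p(\mathbb{Z}) \subset [-m,m]$ for some $m$, and unbounded otherwise; infinite-to-one if $p^{-1}(n)$ is infinite for some $n \in \mathbb{Z}$. ''Every path in $X$ is uniformly ascending (resp. descending, bounded)'' means that every path in $X$ has the property and the constant $m$ can be chosen the same for all paths in $X$. *)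

(* Defs.v *)
From mathcomp Require Import all_boot all_order all_algebra.
From mathcomp Require Import all_classical all_reals all_analysis.

Set Implicit Arguments.
Unset Strict Implicit.
Unset Printing Implicit Defensive.

Import Order.TTheory GRing.Theory Num.Theory.

Local Open Scope classical_set_scope.
Local Open Scope ring_scope.

(* [int] carries no canonical discrete topology, hence the library's
   [discrete_topology] alias, which is convertible to [int]. *)
Definition int_seq_space : topologicalType :=
  prod_topology (fun _ : int => discrete_topology int).

Definition is_path (r : nat) (p : int -> int) : Prop :=
  p 0 = 0 /\ forall i : int, `|p (i + 1) - p i| <= r%:Z.

(* Used as a type, [Path r] coerces to [set_type (Path r)], whose topology is
   the one induced from [int_seq_space]. *)
Definition Path (r : nat) : set int_seq_space := [set p | is_path r p].

Definition path_fun (r : nat) (p : Path r) : int -> int := set_val p.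

Definition shift (p : int -> int) : int -> int := fun i => p (i + 1) - p 1.

Lemma shift_is_path (r : nat) (p : int -> int) :
  is_path r p -> is_path r (shift p).
Proof.
move=> [_ pr]; split=> [|i]; first by rewrite /shift add0r subrr.
by rewrite /shift opprB addrA subrK.
Qed.

Lemma shift_in_Path (r : nat) (p : Path r) :
  (shift (path_fun p) : int_seq_space) \in Path r.
Proof. by apply/mem_set/shift_is_path/(set_mem (valP p)). Qed.

Definition tau (r : nat) (p : Path r) : Path r :=
  exist _ (shift (path_fun p) : int_seq_space) (shift_in_Path p).

Definition tau_invariant (r : nat) (X : set (Path r)) : Prop :=
  @tau r @` X = X.

Definition minimal_path_space (r : nat) (X : set (Path r)) : Prop :=
  [/\ X !=set0, closed X, tau_invariant X &
      forall Y : set (Path r), Y `<=` X -> Y !=set0 -> closed Y ->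
        tau_invariant Y -> Y = X].

Definition ascending_by (m : nat) (p : int -> int) : Prop :=
  forall j : int, p (j + m%:Z + 1) - p j > 0.

Definition descending_by (m : nat) (p : int -> int) : Prop :=
  forall j : int, p (j + m%:Z + 1) - p j < 0.

Definition bounded_by (m : nat) (p : int -> int) : Prop :=
  forall j : int, - m%:Z <= p j <= m%:Z.

Definition unbounded (p : int -> int) : Prop :=
  ~ exists m : nat, bounded_by m p.

Definition infinite_to_one (p : int -> int) : Prop :=
  exists n : int, infinite_set (p @^-1` [set n]).

(* [P m] is a property of paths depending on a constant [m]: the same constant
   serves for all paths in [X]. *)
Definition uniformly (P : nat -> (int -> int) -> Prop) (r : nat)
    (X : set (Path r)) : Prop :=
  exists m : nat, forall p : Path r, X p -> P m (path_fun p).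

Definition exactly_one_of4 (A B C D : Prop) : Prop :=
  [\/ [/\ A, ~ B, ~ C & ~ D],
      [/\ ~ A, B, ~ C & ~ D],
      [/\ ~ A, ~ B, C & ~ D] |
      [/\ ~ A, ~ B, ~ C & D]].

(* Main.v *)
Require Import Defs.
From mathcomp Require Import all_boot all_order all_algebra.
From mathcomp Require Import all_classical all_reals all_analysis.
From mathcomp Require Import zify.

Set Implicit Arguments.
Unset Strict Implicit.
Unset Printing Implicit Defensive.

Import Defs Order.TTheory GRing.Theory Num.Theory.

Local Open Scope classical_set_scope.
Local Open Scope ring_scope.

(** Exclusivity: an ascending (or descending) path of bounded steps takes
    distinct values at distant times, so it is finite-to-one, hence unbounded.

    Existence: a closed condition invariant under [shift] that holds for one
    path of a minimal space holds for all of them ([minimal_all]). Hence one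
    bounded path makes all of them uniformly bounded, and one ascending
    (descending) path makes all of them uniformly so. It remains to find an
    ascending or descending path when every path is finite-to-one.

    If every path of [X] is finite-to-one, each leaves the band [-r, r] for
    good: it belongs to one of the closed sets F_k of the paths with
    |p(i)| > r for all |i| >= k. By Baire's theorem ([baire]) some F_k contains
    all the paths of [X] that agree with a certain f on a window [-n, n]. By
    minimality and compactness this window reappears in f with bounded gaps
    ([bounded_gaps_agree]), so there is a relatively dense set O of times l
    such that |f(i) - f(l)| > r whenever |i - l| >= k. Since the steps of f are
    at most r, it cannot jump across the band around f(l): beyond l + k it
    stays on one side of f(l), and likewise before l - k. Two times of O
    cannot have different sides on their right, for a time of O far to the
    right would then see a value below its own and a value above its own in
    its remote past, where f stays on one side ([same_side]). If the common side is above, f gains more than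
    r each time it goes from a time of O to a later one at distance at least k,
    which makes it ascending ([ascending_of_right_above]). *)

(** * Closedness and compactness by windows *)

Definition agree (n : nat) (f g : int -> int) : Prop :=
  forall i : int, (`|i| <= n)%N -> f i = g i.

Lemma agreeW (m n : nat) (f g : int -> int) :
  (m <= n)%N -> agree n f g -> agree m f g.
Proof. by move=> mn fg i im; apply: fg; apply: leq_trans mn. Qed.

Lemma agree_trans (n : nat) (f g h : int -> int) :
  agree n f g -> agree n g h -> agree n f h.
Proof. by move=> fg gh i ni; rewrite fg ?gh. Qed.

Lemma agree_sym (n : nat) (f g : int -> int) : agree n f g -> agree n g f.
Proof. by move=> fg i ni; rewrite fg. Qed.

(** Closedness in the product topology of discrete spaces: the cylinders given
    by windows are a base of neighbourhoods. *)
Definition limit_closed (C : set (int -> int)) : Prop :=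
  forall f, (forall n, exists2 g, C g & agree n f g) -> C f.

Lemma path_funP (r : nat) (p : Path r) : is_path r (path_fun p).
Proof. exact: set_mem (valP p). Qed.

Definition functions_of (r : nat) (X : set (Path r)) : set (int -> int) :=
  [set f | exists2 p, X p & path_fun p = f].

Lemma functions_of_path (r : nat) (X : set (Path r)) (f : int -> int) :
  functions_of X f -> is_path r f.
Proof. by move=> [p _ <-]; exact: path_funP. Qed.

Lemma nbhs_agree (f : int_seq_space) (n : nat) :
  nbhs f [set g : int_seq_space | agree n f g].
Proof.
have coord i : nbhs f [set g : int_seq_space | f i = g i].
  have := @proj_continuous int (fun=> discrete_topology int) i f.
  move=> /(_ [set x | f i = x]); apply.
  by rewrite nbhs_principalE.
elim: n => [|n IHn].
  by apply: filterS (coord 0) => g fg i i0; have -> : i = 0 by lia.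
apply: filterS (filterI IHn (filterI (coord n.+1%:Z) (coord (- n.+1%:Z)))).
move=> g [fg [pos neg]] i ni; have [/fg //|in_] := leqP `|i|%N n.
by have [->|->] : i = n.+1%:Z \/ i = - n.+1%:Z by lia.
Qed.

Lemma nbhs_contains_agree (f : int_seq_space) (U : set int_seq_space) :
  nbhs f U -> exists n, forall g, agree n f g -> U g.
Proof.
pose F : set_system int_seq_space :=
  filter_from [set: nat] (fun n => [set g : int_seq_space | agree n f g]).
have FF : Filter F.
  apply: filter_from_filter; first by exists 0%N.
  move=> m n _ _; exists (maxn m n) => // g /= fg.
  by split; apply: agreeW fg; lia.
suff Ff : F --> f by move=> /Ff [n _ nU]; exists n => g /nU.
apply/cvg_sup => i V [_ [[W oW <-] Wfi WV]].
by exists `|i|%N => // g fg; apply: WV => /=; rewrite -fg.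
Qed.

(** Being a path of steps at most [r] is a condition on windows, so [Path r]
    is itself closed; closedness in the subspace thus passes to the whole space
    of functions. *)
Lemma closed_limit_closed (r : nat) (Y : set (Path r)) :
  closed Y -> limit_closed (functions_of Y).
Proof.
move=> Ycl f flim.
have f_path : is_path r f.
  split=> [|i].
    by have [_ [p _ <-] ->] := flim 0%N; case: (path_funP p).
  have [_ [p _ <-] fp] := flim (`|i| + 1)%N.
  have [-> ->] : f i = path_fun p i /\ f (i + 1) = path_fun p (i + 1).
    by split; apply: fp; lia.
  by have [_ +] := path_funP p; apply.
pose q : Path r := exist _ (f : int_seq_space) (mem_set f_path).
exists q => //; apply: Ycl => U [_ [[W oW <-] Wq WU]].
have [n nW] : exists n, forall g, agree n f g -> W g.
  by apply: nbhs_contains_agree; exact: open_nbhs_nbhs.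
have [_ [p Yp <-] fp] := flim n.
by exists p; split=> //; apply: WU; apply: nW.
Qed.

Lemma limit_closed_closed (r : nat) (Y : set (Path r)) (Q : set (int -> int)) :
  closed Y -> limit_closed Q -> closed (Y `&` [set p | Q (path_fun p)]).
Proof.
move=> Ycl Qcl; apply: closedI => // p pcl; apply: Qcl => n.
have : nbhs p (set_val @^-1` [set g : int_seq_space | agree n (path_fun p) g]).
  by apply: initial_continuous; exact: nbhs_agree.
by move=> /pcl [q [Qq pq]]; exists (path_fun q).
Qed.

Definition steps_le (r : nat) (f : int -> int) : Prop :=
  forall i : int, `|f (i + 1) - f i| <= r%:Z.

Lemma steps_le_dist (r : nat) (f : int -> int) (n : nat) (i j : int) :
  steps_le r f -> `|i - j| <= n%:Z -> `|f i - f j| <= (r * n)%N%:Z.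
Proof.
move=> fr; wlog ij : i j / j <= i.
  move=> wl; case: (leP j i) => [/wl //|/ltW/wl].
  by rewrite distrC [`|f j - _|]distrC.
elim: n i ij => [|n IHn] i ij ijn; first by rewrite (_ : i = j) ?subrr; lia.
have [->|i_neq_j] := eqVneq i j; first by rewrite subrr.
have := fr (i - 1); rewrite subrK => fi.
have := IHn (i - 1); rewrite mulnS.
move: fi; move: (f i) (f (i - 1)) (f j) => a b c ab cb.
have := cb ltac:(lia) ltac:(lia); lia.
Qed.

Lemma finite_set_norm_le (B : nat) : finite_set [set x : int | `|x| <= B%:Z].
Proof.
apply: (@sub_finite_set _ _ ((fun k : nat => k%:Z - B%:Z) @` `I_B.*2.+1)).
  by move=> x /= xB; exists (absz (x + B%:Z)); lia.
exact/finite_image/finite_II.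
Qed.

(** A path satisfies |p(i)| <= r|i|, so all paths lie in a product of finite
    sets, which is compact by Tychonoff's theorem. *)
Lemma path_seq_compact (r : nat) (u : nat -> int -> int) :
  (forall s, is_path r (u s)) ->
  exists f, forall n N, exists2 s, (N <= s)%N & agree n f (u s).
Proof.
move=> u_path.
pose A (i : int) : set (discrete_topology int) :=
  [set x : int | `|x| <= (r * `|i|)%N%:Z].
have cA i : compact (A i).
  exact/finite_compact/finite_set_norm_le.
have uA s : forall i, A i (u s i).
  move=> i; have [u0 ur] := u_path s.
  have := @steps_le_dist r (u s) `|i|%N i 0 ur; rewrite u0 !subr0; apply; lia.
have uoo : (u @ \oo)
    [set f : forall i : int, discrete_topology int | forall i, A i (f i)].
  by exists 0%N => // s _; exact: uA.
have [f [_ fcl]] :=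
  @tychonoff int (fun=> discrete_topology int) A cA (u @ \oo) _ uoo.
exists f => n N.
have [|g [[s Ns <-] fu]] :=
    fcl [set u s | s in [set s | (N <= s)%N]] _ _ (@nbhs_agree f n).
  by exists N => // s Ns; exists s.
by exists s.
Qed.

(** * Baire's theorem *)

(** The usual proof of Baire's theorem: if no [F k] contained a window of [C],
    one could choose nested windows, the one of rank s+1 missing [F s], and
    their common limit [q] would lie in [C] but in no [F k]. *)
Lemma baire (C : set (int -> int)) (F : nat -> set (int -> int)) :
  C !=set0 -> limit_closed C -> (forall k, limit_closed (F k)) ->
  C `<=` \bigcup_k F k ->
  exists k n f, C f /\ forall g, C g -> agree n f g -> F k g.
Proof.
move=> [f0 Cf0] Ccl Fcl CF; apply: contrapT => noF.
have /choice [step stepP] (x : nat * ((int -> int) * nat)) :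
    exists y : (int -> int) * nat, C x.2.1 ->
      [/\ C y.1, agree x.2.2 x.2.1 y.1, (x.2.2 < y.2)%N &
          forall h, agree y.2 y.1 h -> ~ F x.1 h].
  case: x => k [f n] /=; have [Cf|nCf] := pselect (C f); last by exists (f, n).
  have [g [Cg fg nFg]] : exists g, [/\ C g, agree n f g & ~ F k g].
    apply: contrapT => nog; apply: noF; exists k, n, f; split=> // g Cg fg.
    by apply: contrapT => nFg; apply: nog; exists g.
  have [m gm] : exists m, forall h, agree m g h -> ~ F k h.
    apply: contrapT => nom; apply: nFg; apply: Fcl => m.
    apply: contrapT => noh; apply: nom; exists m => h gh Fh.
    by apply: noh; exists h.
  exists (g, maxn m n.+1); split=> //=; first by lia.
  by move=> h gh; apply: gm; apply: agreeW gh; lia.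
pose z := fix z s := if s is s'.+1 then step (s', z s') else (f0, 0%N).
have Cz s : C (z s).1.
  by elim: s => //= s IHs; have [] := stepP (s, z s) IHs.
have zS s : [/\ agree (z s).2 (z s).1 (z s.+1).1, ((z s).2 < (z s.+1).2)%N &
     forall h, agree (z s.+1).2 (z s.+1).1 h -> ~ F s h].
  by have [] := stepP (s, z s) (Cz s).
have sz s : (s <= (z s).2)%N.
  by elim: s => // s IHs; have [_ + _] := zS s; apply: leq_ltn_trans.
have zD s t : agree (z s).2 (z s).1 (z (s + t)%N).1 /\
    ((z s).2 <= (z (s + t)%N).2)%N.
  elim: t => [|t [IHa IHn]]; first by rewrite addn0.
  have [za zn _] := zS (s + t)%N; rewrite addnS; split; last lia.
  by apply: agree_trans IHa _; apply: agreeW za.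
(* the window of rank s has radius at least s, so the term of rank |i| already
   has the limit value at i *)
pose q (i : int) := (z `|i|%N).1 i.
have zq s : agree (z s).2 (z s).1 q.
  move=> i si; rewrite /q; have [si'|is'] := leqP s `|i|%N.
    by rewrite -(subnKC si'); have [+ _] := zD s (`|i| - s)%N; apply.
  rewrite -(subnKC (ltnW is')).
  by have [/(_ i) -> //] := zD `|i|%N (s - `|i|)%N.
have Cq : C q.
  apply: Ccl => n; exists (z n).1 => //.
  by apply/agree_sym; apply: agreeW (zq n).
by have [k _ Fk] := CF q Cq; have [_ _ /(_ q (zq k.+1))] := zS k.
Qed.

(** * Functions that escape with bounded gaps *)

(** Steps of size at most [r] cannot cross the band [-r, r] at once. *)
Lemma sign_constant (r : nat) (u : nat -> int) :
  (forall i, `|u i.+1 - u i| <= r%:Z) -> (forall i, r%:Z < `|u i|) ->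
  (forall i, r%:Z < u i) \/ (forall i, r%:Z < - u i).
Proof.
move=> ur u_gt.
have step i :
    (r%:Z < u i -> r%:Z < u i.+1) /\ (r%:Z < - u i -> r%:Z < - u i.+1).
  by move: (u_gt i.+1) (ur i); move: (u i) (u i.+1) => a b; lia.
have [u0|u0] : r%:Z < u 0%N \/ r%:Z < - u 0%N by have := u_gt 0%N; lia.
  by left; elim=> // i IHi; apply: (step i).1.
by right; elim=> // i IHi; apply: (step i).2.
Qed.

Definition escapes (r k : nat) (f : int -> int) (l : int) : Prop :=
  forall i : int, (k <= `|i|)%N -> r%:Z < `|f (l + i) - f l|.

(** Staying below is expressed as [right_above] for [\- f]. *)
Definition right_above (r k : nat) (f : int -> int) (l : int) : Prop :=
  forall i : int, l + k%:Z <= i -> r%:Z < f i - f l.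

Definition left_above (r k : nat) (f : int -> int) (l : int) : Prop :=
  forall i : int, i <= l - k%:Z -> r%:Z < f i - f l.

Lemma steps_leN (r : nat) (f : int -> int) : steps_le r f -> steps_le r (\- f).
Proof. by move=> fr i /=; rewrite opprK addrC distrC. Qed.

Lemma right_side (r k : nat) (f : int -> int) (l : int) :
  steps_le r f -> escapes r k f l ->
  right_above r k f l \/ right_above r k (\- f) l.
Proof.
move=> fr far.
have [i|i|up|down] := @sign_constant r (fun i => f (l + (k + i)%N%:Z) - f l).
- have -> : l + (k + i.+1)%N%:Z = l + (k + i)%N%:Z + 1 by lia.
  by rewrite opprB addrA subrK; apply: fr.
- by apply: far; lia.
- left=> i li; have := up (absz (i - l - k%:Z)%R).
  by rewrite (_ : l + _ = i) //; lia.
right=> i li; have := down (absz (i - l - k%:Z)%R).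
by rewrite (_ : l + _ = i) //=; lia.
Qed.

(** The reflection i |-> - i reduces this to the right side. *)
Lemma left_side (r k : nat) (f : int -> int) (l : int) :
  steps_le r f -> escapes r k f l ->
  left_above r k f l \/ left_above r k (\- f) l.
Proof.
move=> fr far.
pose g i := f (- i).
have gr : steps_le r g.
  move=> i; rewrite /g distrC.
  by have := fr (- (i + 1)); rewrite (_ : - (i + 1) + 1 = - i); last lia.
have [i|up|down] := @right_side r k g (- l) gr.
- rewrite /g opprK (_ : - (- l + i) = l - i); last lia.
  by move=> ki; apply: far; rewrite abszN.
- by left=> i il; have := up (- i); rewrite /g !opprK; apply; lia.
by right=> i il; have := down (- i); rewrite /= /g !opprK; apply; lia.
Qed.

Definition bounded_gaps (L : nat) (O : set int) : Prop :=
  forall j : int, exists2 l, O l & j <= l <= j + L%:Z.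

(** If the right side were above for [l] and below for [l'], take [l''] in [O]
    far to the right of both: its value exceeds that at [l] and is below that at
    [l'], so the left side of [l''] could be neither above nor below. *)
Lemma same_side (r k L : nat) (f : int -> int) (O : set int) :
  steps_le r f -> bounded_gaps L O ->
  (forall l, O l -> escapes r k f l) ->
  (forall l, O l -> right_above r k f l) \/
  (forall l, O l -> right_above r k (\- f) l).
Proof.
move=> fr gaps far.
have [[l Ol up]|noup] := pselect (exists2 l, O l & right_above r k f l);
  last first.
  right=> l Ol; have [up|//] := right_side fr (far l Ol).
  by case: noup; exists l.
left=> l' Ol'; have [//|down] := right_side fr (far l' Ol').
have [l'' Ol'' /andP[l''_ge _]] := gaps (`|l| + `|l'| + k%:Z).
have := up l''; have := down l''.
have [above|below] := left_side fr (far l'' Ol'').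
  by have := above l; have /= := above l'; lia.
by have := below l; have /= := below l'; lia.
Qed.

(** From any [j] one reaches a time of [O] within [L], losing at most [r * L];
    each further time of [O], at most [L + k] later, gains at least [1]. *)
Lemma ascending_of_right_above (r k L : nat) (f : int -> int) (O : set int) :
  steps_le r f -> bounded_gaps L O ->
  (forall l, O l -> right_above r k f l) -> exists m, ascending_by m f.
Proof.
move=> fr gaps up.
have climb j n : exists2 l, O l &
    j <= l <= j + (L + n * (L + k))%N%:Z /\ f j - (r * L)%N%:Z + n%:Z <= f l.
  elim: n => [|n [l Ol [/andP[jl lL] fl]]].
    have [l Ol /andP[jl lL]] := gaps j; exists l => //; split; first by lia.
    have := @steps_le_dist r f L l j fr; move: (f l) (f j) => a b ab.
    have := ab ltac:(lia); lia.
  have [l' Ol' /andP[ll' lL']] := gaps (l + k%:Z); exists l' => //.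
  split; first by rewrite mulSn; lia.
  have := up l Ol l' ll'; lia.
exists (L + (r * L).+1 * (L + k) + k)%N => j.
(* [r * L] climbs make up for the initial loss; from [k] after the last time
   reached on, [f] is strictly higher *)
have [l Ol [/andP[jl lL] fl]] := climb j (r * L)%N.
have := up l Ol (j + (L + (r * L).+1 * (L + k) + k)%N%:Z + 1).
rewrite mulSn; lia.
Qed.

Lemma escapes_ascending_or_descending (r k L : nat) (f : int -> int)
    (O : set int) :
  steps_le r f -> bounded_gaps L O ->
  (forall l, O l -> escapes r k f l) ->
  (exists m, ascending_by m f) \/ (exists m, descending_by m f).
Proof.
move=> fr gaps far.
have [up|down] := same_side fr gaps far.
  by left; apply: ascending_of_right_above up.
have [m desc] := ascending_of_right_above (steps_leN fr) gaps down.
by right; exists m => j; have := desc j => /=; lia.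
Qed.

(** * Minimal path spaces *)

Definition shift_by (j : int) (f : int -> int) : int -> int :=
  fun i => f (i + j) - f j.

Lemma shiftE (f : int -> int) : shift f = shift_by 1 f.
Proof. by []. Qed.

Lemma shift_byD (j l : int) (f : int -> int) :
  shift_by j (shift_by l f) = shift_by (j + l) f.
Proof.
by apply/funext => i; rewrite /shift_by opprB addrA subrK addrA.
Qed.

Lemma agree_shift_by (n : nat) (l : int) (f g : int -> int) :
  agree (n + `|l|) f g -> agree n (shift_by l f) (shift_by l g).
Proof. by move=> fg i ni; rewrite /shift_by !fg //; lia. Qed.

(** Backward shifts use the surjectivity of [tau] on [X]; a path is determined
    by its shift because it vanishes at [0]. *)
Lemma functions_of_shift_by (r : nat) (X : set (Path r)) (j : int)
    (f : int -> int) :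
  tau_invariant X -> functions_of X f -> functions_of X (shift_by j f).
Proof.
move=> Xtau Xf.
have fwd (n : nat) (g : int -> int) :
    functions_of X g -> functions_of X (shift_by n%:Z g).
  move=> Xg; elim: n => [|n [p Xp pg]].
    have [g0 _] := functions_of_path Xg.
    rewrite (_ : shift_by _ _ = g) //.
    by apply/funext => i; rewrite /shift_by addr0 g0 subr0.
  exists (tau p); first by rewrite -Xtau; exists p.
  have -> : n.+1%:Z = 1 + n%:Z by lia.
  by rewrite -shift_byD -pg.
have bwd (n : nat) (g : int -> int) :
    functions_of X g -> functions_of X (shift_by (- n%:Z) g).
  move=> Xg; elim: n => [|n [p Xp pg]]; first exact: (fwd 0%N).
  have : X p by []. rewrite -{1}Xtau => -[p' Xp' p'p].
  exists p' => //.
  have p'E : shift (path_fun p') = shift_by (- n%:Z) g by rewrite -pg -p'p.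
  have [p'0 _] := path_funP p'; apply/funext => i.
  have := congr1 (@^~ (i - 1)) p'E; have := congr1 (@^~ (-1)) p'E.
  rewrite /= /shift /shift_by subrK addNr p'0.
  rewrite (_ : -1 - n%:Z = - n.+1%:Z); last lia.
  rewrite (_ : i - 1 - n%:Z = i - n.+1%:Z); last lia.
  move: (path_fun p' i) (path_fun p' 1) (g _) (g _) (g _) => a b c d e; lia.
have [->|->] : j = `|j|%N%:Z \/ j = - `|j|%N%:Z by lia.
  exact: fwd.
exact: bwd.
Qed.

(** The paths of [X] satisfying [Q] form a closed invariant subset of [X]. *)
Lemma minimal_all (r : nat) (X : set (Path r)) (Q : set (int -> int))
    (f g : int -> int) :
  minimal_path_space X -> limit_closed Q -> (forall h, Q h <-> Q (shift h)) ->
  functions_of X f -> Q f -> functions_of X g -> Q g.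
Proof.
move=> [_ Xcl Xtau Xmin] Qcl Qshift [p Xp <-] Qp [q Xq <-].
suff XQ : X `&` [set p | Q (path_fun p)] = X by move: Xq; rewrite -XQ => -[].
apply: Xmin => [? []// | | | ]; first by exists p.
  exact: limit_closed_closed.
apply/seteqP; split=> [_ [p' [Xp' Qp'] <-]|p' [Xp' Qp']].
  by split; [rewrite -Xtau; exists p' | exact: (Qshift _).1 Qp'].
move: Xp'; rewrite -{1}Xtau => -[p'' Xp'' p''p']; exists p'' => //; split=> //.
by apply/Qshift; move: Qp'; rewrite -p''p'.
Qed.

(** Conditions that each look at finitely many times cut out closed sets,
    because the cylinders are also closed. *)
Lemma limit_closed_local (T : Type) (P : T -> (int -> int) -> Prop) :
  (forall t, exists n, forall f g, agree n f g -> P t g -> P t f) ->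
  limit_closed [set f | forall t, P t f].
Proof.
move=> Ploc f flim t; have [n nP] := Ploc t.
by have [g Pg fg] := flim n; apply: nP fg _.
Qed.

(** If the window [-n, n] of [f] could be absent from arbitrarily long stretches
    of paths of [X], compactness would give a path of [X] where it never occurs;
    that is a closed invariant condition, so it would not occur in [f]. *)
Lemma bounded_gaps_agree (r : nat) (X : set (Path r)) (f : int -> int)
    (n : nat) :
  minimal_path_space X -> functions_of X f ->
  exists L, bounded_gaps L [set l | agree n f (shift_by l f)].
Proof.
move=> Xmin Xf; have [_ Xcl Xtau _] := Xmin.
suff [L LP] : exists L : nat, forall g, functions_of X g ->
    exists2 l : int, (`|l| <= L)%N & agree n f (shift_by l g).
  exists (L + L)%N => j.
  have [l lL fl] := LP _ (functions_of_shift_by (j + L%:Z) Xtau Xf).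
  exists (l + (j + L%:Z)); last by lia.
  by rewrite /= -shift_byD.
apply: contrapT => noL.
have /choice [u uP] (L : nat) : exists g, functions_of X g /\
    forall l : int, (`|l| <= L)%N -> ~ agree n f (shift_by l g).
  apply: contrapT => nog; apply: noL; exists L => g Xg.
  apply: contrapT => nol; apply: nog; exists g; split=> // l lL fl.
  by apply: nol; exists l.
have [g gu] := path_seq_compact (fun s => functions_of_path (uP s).1).
have Xg : functions_of X g.
  apply: (closed_limit_closed Xcl) => m.
  by have [s _ gs] := gu m 0%N; exists (u s) => //; exact: (uP s).1.
pose Q := [set h | forall l : int, ~ agree n f (shift_by l h)].
have Qg : Q g.
  move=> l fl; have [s ls gs] := gu (n + `|l|)%N `|l|%N.
  by apply: (uP s).2 ls _; apply: agree_trans fl (agree_shift_by gs).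
have Qcl : limit_closed Q.
  apply: limit_closed_local => l; exists (n + `|l|)%N => h h' hh' Qh' fh.
  by apply: Qh'; apply: agree_trans fh (agree_shift_by hh').
have Qshift h : Q h <-> Q (shift h).
  split=> Qh l; first by rewrite shiftE shift_byD.
  by have := Qh (l - 1); rewrite shiftE shift_byD subrK.
have /(_ 0) := minimal_all Xmin Qcl Qshift Xg Qg Xf; apply.
have [f0 _] := functions_of_path Xf.
by move=> i _; rewrite /shift_by addr0 f0 subr0.
Qed.

(** * Paths with finite fibres *)

Lemma finite_to_one_band (f : int -> int) (B : nat) :
  ~ infinite_to_one f -> finite_set [set i | `|f i| <= B%:Z].
Proof.
move=> fin; rewrite (_ : [set i | _] =
    \bigcup_(v in [set v : int | `|v| <= B%:Z]) (f @^-1` [set v])).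
  apply: bigcup_finite; first exact: finite_set_norm_le.
  by move=> v _; apply: contrapT => inf; apply: fin; exists v.
by apply/seteqP; split=> [i fi|i [v vB /= ->]] //; exists (f i).
Qed.

Lemma finite_set_int_bounded (A : set int) :
  finite_set A -> exists k : nat, forall i, (k <= `|i|)%N -> ~ A i.
Proof.
move=> /finite_fsetP[B ->].
exists (\max_(i <- finmap.enum_fset B) `|i|%N).+1 => i + Bi.
by apply/negP; rewrite -ltnNge ltnS; apply: leq_bigmax_seq.
Qed.

(** * Minimal spaces of finite-to-one paths *)

(** Baire's theorem provides a window of [f] which forces a path of [X] to leave
    the band [-r, r] within time [k]; this applies to the shift of [f] to each
    reappearance of that window. *)
Lemma minimal_ascending_or_descending (r : nat) (X : set (Path r)) :
  minimal_path_space X -> (forall f, functions_of X f -> ~ infinite_to_one f) ->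
  exists2 f, functions_of X f &
    (exists m, ascending_by m f) \/ (exists m, descending_by m f).
Proof.
move=> Xmin fin; have [[p Xp] Xcl Xtau _] := Xmin.
pose F (k : nat) := [set f : int -> int |
  forall i : int, (k <= `|i|)%N -> r%:Z < `|f i|].
have Fcl k : limit_closed (F k).
  apply: limit_closed_local => i; exists `|i|%N => f g fg Fg ki.
  by rewrite fg //; apply: Fg.
have XF : functions_of X `<=` \bigcup_k F k.
  move=> f Xf.
  have [k kP] := finite_set_int_bounded (finite_to_one_band r (fin f Xf)).
  by exists k => // i /kP /= /negP; rewrite -ltNge.
have [|k [n [f [Xf fF]]]] := baire _ (closed_limit_closed Xcl) Fcl XF.
  by exists (path_fun p), p.
exists f => //; have [L gaps] := bounded_gaps_agree n Xmin Xf.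
have [_ fr] := functions_of_path Xf.
apply: escapes_ascending_or_descending fr gaps _ => l fl i ki.
have := fF _ (functions_of_shift_by l Xtau Xf) fl i ki.
by rewrite /shift_by [i + l]addrC.
Qed.

(** * Monotone paths are finite-to-one *)

Lemma ascending_iter (m n : nat) (f : int -> int) (j : int) :
  ascending_by m f -> f j + n%:Z <= f (j + (m.+1 * n)%N%:Z).
Proof.
move=> asc; elim: n => [|n IHn]; first by rewrite muln0 !addr0.
have := asc (j + (m.+1 * n)%N%:Z).
rewrite (_ : j + _ + _ + _ = j + (m.+1 * n.+1)%N%:Z); last first.
  by rewrite mulnS; lia.
by move: IHn; move: (f _) (f _) (f _) => a b c; lia.
Qed.

(** Write [j - i = (m + 1) * q + b] with [b <= m]: the [q] periods gain at least
    [q], which exceeds the loss [r * (m + 1)] over the remainder. *)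
Lemma ascending_far (m r : nat) (f : int -> int) :
  steps_le r f -> ascending_by m f ->
  exists K : nat, forall i j, i + K%:Z <= j -> f i < f j.
Proof.
move=> fr asc; pose n := (r * m.+1).+1.
exists (m.+1 * n)%N => i j ij.
pose q := (absz (j - i)%R %/ m.+1)%N; pose b := (absz (j - i)%R %% m.+1)%N.
have jE : j = i + (m.+1 * q)%N%:Z + b%:Z.
  by have := divn_eq (absz (j - i)%R) m.+1; rewrite mulnC -/q -/b; lia.
have bm : (b < m.+1)%N by rewrite ltn_pmod.
have nq : (n <= q)%N by rewrite leq_divRL // mulnC; lia.
have := ascending_iter q i asc.
have := @steps_le_dist r f m.+1 j (i + (m.+1 * q)%N%:Z) fr.
move: (f i) (f j) (f _) => a b' c h1 h2; have := h1 ltac:(lia); lia.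
Qed.

Lemma descending_far (m r : nat) (f : int -> int) :
  steps_le r f -> descending_by m f ->
  exists K : nat, forall i j, i + K%:Z <= j -> f j < f i.
Proof.
move=> fr desc; have [|K KP] := @ascending_far m r (\- f) (steps_leN fr).
  by move=> j; have := desc j => /=; lia.
by exists K => i j /KP /=; rewrite ltrN2.
Qed.

Lemma separated_finite_to_one (K : nat) (f : int -> int) :
  (forall i j, i + K%:Z <= j -> f i <> f j) -> ~ infinite_to_one f.
Proof.
move=> sep [v]; apply.
have [[i0 fi0]|empty] := pselect (exists i, f i = v); last first.
  rewrite (_ : _ @^-1` _ = set0) //; apply/seteqP; split=> // i fi.
  by case: empty; exists i.
apply: sub_finite_set (finite_set_norm_le (`|i0| + K)) => i /= fi.
by have := sep i i0; have := sep i0 i; rewrite fi fi0; lia.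
Qed.

Lemma finite_to_one_unbounded (f : int -> int) :
  ~ infinite_to_one f -> unbounded f.
Proof.
move=> fin [m bm].
have [k kP] := finite_set_int_bounded (finite_to_one_band m fin).
by have := bm k; have := kP k (leqnn _) => /=; lia.
Qed.

(** * From one path to all *)

(** Increments do not depend on the normalisation at [0], so a condition on all
    the increments at distance [d] is invariant under [shift]. *)
Lemma minimal_increments (r : nat) (X : set (Path r)) (d : int)
    (P : int -> Prop) (f g : int -> int) :
  minimal_path_space X -> functions_of X f -> (forall j, P (f (j + d) - f j)) ->
  functions_of X g -> forall j, P (g (j + d) - g j).
Proof.
move=> Xmin Xf Pf Xg.
pose Q := [set h : int -> int | forall j, P (h (j + d) - h j)].
apply: (@minimal_all r X Q f g Xmin _ _ Xf Pf Xg).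
  apply: limit_closed_local => j; exists (`|j| + `|d|)%N => h h' hh'.
  by rewrite !hh' //; lia.
have incr h j : shift h (j + d) - shift h j = h (j + 1 + d) - h (j + 1).
  by rewrite /shift opprB addrA subrK [j + d + 1]addrAC.
move=> h; split=> Ph j; first by rewrite incr.
by have := Ph (j - 1); rewrite incr subrK.
Qed.

Lemma minimal_uniformly_ascending (r m : nat) (X : set (Path r))
    (f : int -> int) :
  minimal_path_space X -> functions_of X f -> ascending_by m f ->
  uniformly ascending_by X.
Proof.
move=> Xmin Xf asc; exists m => p Xp j; rewrite -addrA.
apply: (@minimal_increments r X _ (fun x => x > 0) f) => //; last by exists p.
by move=> {}j; rewrite addrA.
Qed.

Lemma minimal_uniformly_descending (r m : nat) (X : set (Path r))
    (f : int -> int) :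
  minimal_path_space X -> functions_of X f -> descending_by m f ->
  uniformly descending_by X.
Proof.
move=> Xmin Xf desc; exists m => p Xp j; rewrite -addrA.
apply: (@minimal_increments r X _ (fun x => x < 0) f) => //; last by exists p.
by move=> {}j; rewrite addrA.
Qed.

Lemma minimal_uniformly_bounded (r m : nat) (X : set (Path r))
    (f : int -> int) :
  minimal_path_space X -> functions_of X f -> bounded_by m f ->
  uniformly bounded_by X.
Proof.
move=> Xmin Xf fm; exists (m + m)%N => p Xp j.
have [p0 _] := path_funP p.
suff : `|path_fun p (0 + j) - path_fun p 0| <= (m + m)%N%:Z.
  by rewrite p0 add0r; lia.
(* the value at [j] is the increment at distance [j] from [0], and increments
   of a function bounded by [m] are bounded by [2 * m] *)
apply: (@minimal_increments r X j (fun x => `|x| <= (m + m)%N%:Z) f) => //.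
  by move=> i; have := fm (i + j); have := fm i; move: (f _) (f _) => a b; lia.
by exists p.
Qed.

Theorem theorem4p1 (r : nat) (X : set (Path r)) (hX : minimal_path_space X) :
  exactly_one_of4
    (uniformly ascending_by X)
    (uniformly descending_by X)
    (uniformly bounded_by X)
    ((forall p : Path r, X p -> unbounded (path_fun p)) /\
     (exists p : Path r, X p /\ infinite_to_one (path_fun p))).
Proof.
have [[p0 Xp0] _ _ _] := hX.
have steps (p : Path r) : steps_le r (path_fun p) by case: (path_funP p).
have asc_fin m (p : Path r) :
    ascending_by m (path_fun p) -> ~ infinite_to_one (path_fun p).
  move=> /(ascending_far (steps p)) [K KP].
  by apply: (@separated_finite_to_one K) => i j /KP; lia.
have desc_fin m (p : Path r) :
    descending_by m (path_fun p) -> ~ infinite_to_one (path_fun p).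
  move=> /(descending_far (steps p)) [K KP].
  by apply: (@separated_finite_to_one K) => i j /KP; lia.
have asc_desc : uniformly ascending_by X -> ~ uniformly descending_by X.
  move=> [m /(_ _ Xp0) asc] [m' /(_ _ Xp0) desc].
  have [K KP] := ascending_far (steps p0) asc.
  have [K' KP'] := descending_far (steps p0) desc.
  have up := KP 0 (K + K')%N%:Z; have down := KP' 0 (K + K')%N%:Z.
  by have := lt_trans (up ltac:(lia)) (down ltac:(lia)); rewrite ltxx.
have not_bounded (p : Path r) :
    X p -> ~ infinite_to_one (path_fun p) -> ~ uniformly bounded_by X.
  move=> Xp /finite_to_one_unbounded unb [m bm].
  by apply: unb; exists m; apply: bm.
have [asc|nasc] := pselect (uniformly ascending_by X).
  have [m mP] := asc; apply: Or41; split=> //; first exact: asc_desc.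
  - exact: not_bounded Xp0 (asc_fin _ _ (mP _ Xp0)).
  - by move=> [_ [p [Xp]]]; exact: asc_fin (mP p Xp).
have [desc|ndesc] := pselect (uniformly descending_by X).
  have [m mP] := desc; apply: Or42; split=> //.
  - exact: not_bounded Xp0 (desc_fin _ _ (mP _ Xp0)).
  - by move=> [_ [p [Xp]]]; exact: desc_fin (mP p Xp).
have [bnd|nbnd] := pselect (uniformly bounded_by X).
  apply: Or43; split=> // -[unb _].
  by have [m mP] := bnd; apply: (unb _ Xp0); exists m; exact: mP.
apply: Or44; split=> //; split=> [p Xp [m bm]|].
  by apply: nbnd; apply: minimal_uniformly_bounded bm => //; exists p.
apply: contrapT => noinf.
have fin f : functions_of X f -> ~ infinite_to_one f.
  by move=> [p Xp <-] inf; apply: noinf; exists p.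
have [f Xf [[m asc]|[m desc]]] := minimal_ascending_or_descending hX fin.
  by apply: nasc; apply: minimal_uniformly_ascending asc.
by apply: ndesc; apply: minimal_uniformly_descending desc.
Qed.
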